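(* There are absolute constants $c>0$, $c_0>0$ and $d_0$ such that the following holds for all $d\ge d_0$. Let $\Sigma=(V,E)$ be a $d$-regular bipartite graph with $N=|V|\ge d^2$ vertices and bipartite expansion constant $\delta=\delta(\Sigma)$. If $\delta\ge c\log^3 d/d$, then the mixing time of the Glauber dynamics chain $\mathcal M_1(\Sigma)$ (activity $\lambda=1$) satisfies $$\tau_{\mathcal M_1(\Sigma)}\ \ge\ 2^{\,c_0 N\delta/\log d}.$$
   Context: Here $\log=\log_2$. Graphs are finite and simple. $\Sigma=(V,E)$ is a $d$-regular bipartite graph with partition classes $\mathcal E$ and $\mathcal O$; $N=|V|$ and $M=|\mathcal E|=|\mathcal O|=N/2$. Closure and expansion: For $u\in V$, $N(u)$ is the set of neighbours of $u$, and $N(A)=\bigcup_{w\in A}N(w)$. For $A\subseteq\mathcal E$ or $A\subseteq\mathcal O$ put $[A]=\{x\in V: N(x)\subseteq N(A)\}$; $A$ is small if $|[A]|\le M/2$. The bipartite expansion constant is $$\delta(\Sigma)=\min\left\{\frac{|N(A)|-|[A]|}{|N(A)|}: A\ne\emptyset,\ A\subseteq\mathcal E\text{ small or }A\subseteq\mathcal O\text{ small}\right\}.$$ Glauber dynamics: $\mathcal I(\Sigma)$ is the set of independent sets of $\Sigma$. For $\lambda>0$, $\mathcal M_\lambda(\Sigma)$ is the Markov chain on $\mathcal I(\Sigma)$ with transition probabilities, for $I,J\in\mathcal I(\Sigma)$: $P_\lambda(I,J)=0$ if $|I\triangle J|>1$; $P_\lambda(I,J)=\frac1{|V|}\frac{\lambda}{1+\lambda}$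 if $|I\triangle J|=1$ and $I\subseteq J$; $P_\lambda(I,J)=\frac1{|V|}\frac1{1+\lambda}$ if $|I\triangle J|=1$ and $J\subseteq I$; and $P_\lambda(I,I)=1-\sum_{J'\ne I}P_\lambda(I,J')$. Its stationary distribution is the hard-core measure $\pi_\lambda(\{I\})=\lambda^{|I|}/\sum_{J\in\mathcal I(\Sigma)}\lambda^{|J|}$ (uniform on $\mathcal I(\Sigma)$ when $\lambda=1$). Mixing time: for an ergodic chain $\mathcal M$ on a finite state space $\Omega$ with stationary distribution $\pi$ and $t$-step distributions $P^t(\omega_0,\cdot)$, $$\tau_{\mathcal M}=\max_{\omega_0\in\Omega}\min\left\{t_0:\ \tfrac12\sum_{\omega\in\Omega}|P^t(\omega_0,\omega)-\pi(\omega)|\le \tfrac1e\ \ \forall t>t_0\right\}.$$ *)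

(* Defs.v *)
From mathcomp Require Import all_boot all_order all_algebra.
From mathcomp Require Import all_classical all_reals all_analysis.

Set Implicit Arguments.
Unset Strict Implicit.
Unset Printing Implicit Defensive.

Import Order.TTheory GRing.Theory Num.Theory.

Local Open Scope ring_scope.

Definition log2 (R : realType) (x : R) : R := ln x / ln 2.

Section Graph.
Variables (T : finType) (e : rel T).

Definition simple_graph : Prop := symmetric e /\ irreflexive e.

Definition nbh (x : T) : {set T} := [set y | e x y].

Definition nbhs_of (A : {set T}) : {set T} := \bigcup_(w in A) nbh w.

Definition d_regular (d : nat) : Prop := forall x : T, #|nbh x| = d.

Definition bipartition (Ev Od : {set T}) : Prop :=
  [/\ Ev :|: Od = [set: T], [disjoint Ev & Od] &
      forall x y : T, e x y ->
        (x \in Ev) && (y \in Od) || (x \in Od) && (y \in Ev)].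

(* The closure [A] = {x in V : N(x) \subset N(A)}. *)
Definition closure_of (A : {set T}) : {set T} :=
  [set x | nbh x \subset nbhs_of A].

(* A is a small subset of the partition class X, |[A]| <= |X| / 2; in a
   d-regular bipartite graph with d > 0 both classes have size M = |V| / 2. *)
Definition small_in (X A : {set T}) : bool :=
  (A \subset X) && (2 * #|closure_of A| <= #|X|)%N.

Definition expansion_ratio (R : realType) (A : {set T}) : R :=
  (#|nbhs_of A|%:R - #|closure_of A|%:R) / #|nbhs_of A|%:R.

(* Every ratio is at most 1, so the unit 1 of the iterated minimum does not
   affect the minimum over a nonempty family. *)
Definition bip_expansion (R : realType) (Ev Od : {set T}) : R :=
  \big[Num.min/1]_(A : {set T} |
      (A != finset.set0) && (small_in Ev A || small_in Od A)) expansion_ratio R A.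

Definition independent (I : {set T}) : bool :=
  [forall x in I, forall y in I, ~~ e x y].

Definition indep_set : finType := {I : {set T} | independent I}.

Definition symdiff (A B : {set T}) : {set T} := (A :\: B) :|: (B :\: A).

Definition glauber_move (R : realType) (lambda : R) (I J : indep_set) : R :=
  if (1 < #|symdiff (val I) (val J)|)%N then 0
  else if val I \subset val J then #|T|%:R^-1 * (lambda / (1 + lambda))
  else #|T|%:R^-1 * (1 / (1 + lambda)).

Definition glauber (R : realType) (lambda : R) (I J : indep_set) : R :=
  if J == I then 1 - \sum_(J' : indep_set | J' != I) glauber_move lambda I J'
  else glauber_move lambda I J.

Definition hard_core (R : realType) (lambda : R) (I : indep_set) : R :=
  lambda ^+ #|val I| / \sum_(J : indep_set) lambda ^+ #|val J|.

End Graph.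

Section MarkovChain.
Variables (R : realType) (Omega : finType).

Fixpoint t_step (P : Omega -> Omega -> R) (t : nat) (x y : Omega) : R :=
  if t is t'.+1 then \sum_(z : Omega) t_step P t' x z * P z y
  else (x == y)%:R.

Definition tv_distance (mu nu : Omega -> R) : R :=
  2^-1 * \sum_(w : Omega) `|mu w - nu w|.

Definition mixed_after (P : Omega -> Omega -> R) (pi : Omega -> R)
    (x : Omega) (t0 : nat) : Prop :=
  forall t : nat, (t0 < t)%N ->
    tv_distance (t_step P t x) pi <= (expR 1)^-1.

(* The infimum of a nonempty set of naturals is its minimum; this set is
   nonempty for every x when P is ergodic with stationary distribution pi,
   and the value is +oo by convention otherwise. *)
Definition mixing_time (P : Omega -> Omega -> R) (pi : Omega -> R) : \bar R :=
  \big[maxe/-oo%E]_(x : Omega)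
    ereal_inf [set t0%:R%:E | t0 in [set t0 : nat | mixed_after P pi x t0]]%classic.

End MarkovChain.

(* Main.v *)
(* The bottleneck is the set of balanced independent sets, those with
   [|I :&: Ev| = |I :&: Od|]: a single-site update cannot pass from [Ev]-dominated
   to [Od]-dominated sets without meeting one. Each of the two dominated families has at
   least [2 ^ (M - 1)] members, so it is enough to show that there are at most
   [2 ^ (M - Omega(M delta / log d))] balanced sets.

   If [I] is independent, one of [A = I :&: Ev], [I :&: Od] is small, say [A]; given [A],
   the rest of [I] is a subset of [Od :\: N(A)], so the balanced sets with [|A| > M / 32]
   number at most the sum over [A] of [2 ^ (M - |N(A)|)] (those with [|A| <= M / 32]
   are counted trivially). This sum is bounded by the container method of Sapozhenko.
   With [psi = d / (16 log d)], greedily chosen sets [X \subset [A]] and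
   [Y \subset Od :\: N(A)], of size at most [M / psi], determine [S] containing [[A]] and
   [F] contained in [N(A)] with [d (|S| - |F|) <= 4 psi t], where
   [t = |N(A)| - |[A]| >= delta |N(A)|].
   The hypothesis [delta >= c log^3 d / d] makes the number of pairs [(X, Y)]
   negligible, and for a fixed pair either [S] is smaller than [N(A)] by a multiple of
   [t / log d], or [N(A)] differs from [F] by so little that specifying it costs less
   than the gain [2 ^ (- t)] obtained from [A \subset [A]]. *)
Require Import Defs.
From mathcomp Require Import all_boot all_order all_algebra.
From mathcomp Require Import all_classical all_reals all_analysis.
From mathcomp Require Import ring lra zify fintype finset.

Import Order.TTheory GRing.Theory Num.Theory.

Local Open Scope ring_scope.

Set Implicit Arguments.
Unset Strict Implicit.
Unset Printing Implicit Defensive.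

(** * Counting subsets *)

Lemma ln2_ge_half (R : realType) : (2^-1 : R) <= ln 2.
Proof.
have /le_ln1Dx : (-1 : R) < - 2^-1 by lra.
have -> : (1 - 2^-1 : R) = 2^-1 by lra.
by rewrite lnV ?posrE//; lra.
Qed.

Lemma onep_le_powR2 (R : realType) (x : R) : 0 <= x -> 1 + x <= 2 `^ (2 * x).
Proof.
move=> x0; apply: (le_trans (expR_ge1Dx x)).
rewrite /powR pnatr_eq0 /= ler_expR.
by have := ln2_ge_half R; nra.
Qed.

Lemma ler_powR2 (R : realType) (x y : R) : x <= y -> 2 `^ x <= 2 `^ y.
Proof. by move=> xy; apply: ler_powR => //; rewrite ler1n. Qed.

Lemma powR2D (R : realType) (x y : R) : 2 `^ (x + y) = 2 `^ x * 2 `^ y.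
Proof. by rewrite powRD// pnatr_eq0 implybT. Qed.

Lemma powR2_nat (R : realType) (n : nat) : (2 `^ n%:R : R) = (2 ^ n)%:R.
Proof. by rewrite powR_mulrn// natrX. Qed.

Lemma sum_subset_expr (R : comPzRingType) (T : finType) (q : R) :
  \sum_(W : {set T}) q ^+ #|W| = (1 + q) ^+ #|T|.
Proof.
have := @bigA_distr R 0 1 *%R +%R T (fun=> q) (fun=> 1).
rewrite prodr_const addrC => ->; apply: eq_bigr => W _.
by rewrite -big_mkcond prodr_const.
Qed.

Lemma sum_subset_powR2 (R : realType) (T : finType) (L : R) :
  \sum_(W : {set T}) 2 `^ (- (L * #|W|%:R)) <= 2 `^ (2 * #|T|%:R * 2 `^ (- L)).
Proof.
have -> : \sum_(W : {set T}) 2 `^ (- (L * #|W|%:R)) = (1 + 2 `^ (- L)) ^+ #|T|.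
  rewrite -sum_subset_expr; apply: eq_bigr => W _.
  by rewrite -mulNr powRrM powR_mulrn// powR_ge0.
rewrite (_ : 2 * _ * _ = 2 * 2 `^ (- L) * #|T|%:R); last by rewrite mulrAC.
rewrite powRrM powR_mulrn ?powR_ge0//.
by apply: lerXn2r; rewrite ?nnegrE ?addr_ge0 ?powR_ge0// onep_le_powR2 ?powR_ge0.
Qed.

(* Markov's inequality for the weights [2 ^ (- L |A|)], for any [L]. *)
Lemma card_small_subsets (R : realType) (T : finType) (L psi m : R) :
  0 <= L -> 0 < psi ->
  #|[set A : {set T} | psi * #|A|%:R <= m]|%:R <=
    2 `^ (L * m / psi + 2 * #|T|%:R * 2 `^ (- L)).
Proof.
move=> L0 psi0; rewrite powR2D.
apply: le_trans (ler_wpM2l (powR_ge0 _ _) (sum_subset_powR2 T L)).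
rewrite mulr_sumr -sum1_card natr_sum big_mkcond/=.
apply: ler_sum => A _; rewrite inE -powR2D; case: ifPn => [Am|_]; last exact: powR_ge0.
rewrite -[leLHS](powRr0 2); apply: ler_powR2.
rewrite -mulrA -mulrBr mulr_ge0// subr_ge0.
by rewrite ler_pdivlMr// mulrC.
Qed.

Lemma powR2_log2 (R : realType) (n : nat) : (0 < n)%N -> 2 `^ (log2 n%:R) = n%:R :> R.
Proof.
move=> n0; rewrite /powR pnatr_eq0 /= /log2 divfK ?lnK ?posrE ?ltr0n//.
by rewrite gt_eqF// ln_gt0 ?ltr1n.
Qed.

Lemma log2_ge1 (R : realType) (n : nat) : (2 <= n)%N -> 1 <= log2 (n%:R : R).
Proof.
move=> n2; rewrite /log2 ler_pdivlMr ?ln_gt0 ?ltr1n// mul1r.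
by rewrite ler_ln ?posrE ?ltr0n ?ler_nat// (leq_trans _ n2).
Qed.

(** Exponent bookkeeping for [card_indep_heavy]. In terms of [x = delta M / l] and [y = M / d] the
    hypothesis is [40 * 256 y l ^ 2 <= x], where 40 = 32 + 8 collects the coefficients of the
    container cost. *)
Lemma heavy_exponent (R : realType) (l d delta M : R) :
  1 <= l -> 0 < d -> 0 <= M -> 40 * 256 * l ^+ 3 / d <= delta ->
  32 * M * l ^+ 2 / d + 8 * M / d <= delta * M / (256 * l) /\
  4 * M / d + 32 * M * l ^+ 2 / d + 8 * M / d <= delta * M / 64 - delta * M / (256 * l).
Proof.
move=> l1 d0 M0 hd; have l0 : 0 < l by lra.
set y := M / d; set x := delta * M / l.
have y0 : 0 <= y by rewrite divr_ge0// ltW.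
have xE : delta * M = x * l by rewrite divfK// gt_eqF.
have hx : 40 * 256 * (y * l ^+ 2) <= x.
  rewrite ler_pdivlMr// (_ : _ * l = 40 * 256 * l ^+ 3 / d * M); last by rewrite /y; ring.
  exact: ler_wpM2r.
have hy : y <= y * l ^+ 2 by rewrite ler_peMr// expr_ge1// ltW.
have x0 : 0 <= x by lra.
have -> : delta * M / (256 * l) = x / 256 by rewrite /x invfM; ring.
rewrite xE.
have -> : 32 * M * l ^+ 2 / d = 32 * (y * l ^+ 2) by rewrite /y; ring.
have -> : 8 * M / d = 8 * y by rewrite /y; ring.
have -> : 4 * M / d = 4 * y by rewrite /y; ring.
have : x <= x * l by rewrite ler_peMr.
by split; lra.
Qed.

(** * Slow mixing from a bottleneck *)

(** Puts the mixing threshold [1 / e] at most at [4 / 9], which is [1 / 18] below [1 / 2]. *)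
Lemma expR1_gt (R : realType) : (9 / 4 : R) <= expR 1.
Proof.
have -> : (1 : R) = 2^-1 * 2%:R by rewrite mulVf.
rewrite expRM_natr; have := expR_ge1Dx (2^-1 : R).
by rewrite expr2; nra.
Qed.

Section SymmetricChain.
Context {R : realType} {Omega : finType}.
Variable P : Omega -> Omega -> R.
Hypothesis P_ge0 : forall x y, 0 <= P x y.
Hypothesis P_sum : forall x, \sum_y P x y = 1.
Hypothesis P_sym : forall x y, P x y = P y x.

Lemma t_step_ge0 t x y : 0 <= t_step P t x y.
Proof.
elim: t y => [|t IH] y /=; first exact: ler0n.
by apply: sumr_ge0 => z _; rewrite mulr_ge0.
Qed.

Lemma t_step_sum t x : \sum_y t_step P t x y = 1.
Proof.
elim: t => [|t IH] /=.
  by rewrite (bigD1 x)//= eqxx big1 ?addr0// => y /negPf yx; rewrite eq_sym yx.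
rewrite exchange_big /= -[RHS]IH; apply: eq_bigr => z _.
by rewrite -mulr_sumr P_sum mulr1.
Qed.

Lemma t_step_sum_col t y : \sum_x t_step P t x y = 1.
Proof.
elim: t y => [|t IH] y /=.
  by rewrite (bigD1 y)//= eqxx big1 ?addr0// => x /negPf ->.
rewrite exchange_big /= -[RHS](P_sum y); apply: eq_bigr => z _.
by rewrite -mulr_suml IH mul1r P_sym.
Qed.

(** Induction on time: mass outside [S] was already outside one step earlier, or has just crossed
    the cut. The latter is at most one unit of flow, because symmetry makes every column of
    [t_step P t] sum to 1. *)
Lemma t_step_escape (S : {set Omega}) t :
  \sum_(y in ~: S) \sum_(x in S) t_step P t x y <=
  t%:R * \sum_(z in S) \sum_(y in ~: S) P z y.
Proof.
have sum_le1 s (A : {set Omega}) z : \sum_(x in A) t_step P s x z <= 1.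
  rewrite -(t_step_sum_col s z) [leRHS](bigID (mem A))/= lerDl.
  by apply: sumr_ge0 => x _; exact: t_step_ge0.
elim: t => [|t IH].
  rewrite mul0r big1// => y; rewrite inE => yS.
  by apply: big1 => x xS /=; case: eqP xS yS => // ->; case: (_ \in _).
under eq_bigr => y _.
  rewrite /= exchange_big/=; under eq_bigr => z _ do rewrite -mulr_suml.
  over.
rewrite exchange_big/= (bigID (mem S))/= addrC -nat1r mulrDl mul1r addrC.
apply: lerD.
  apply: ler_sum => z _; apply: ler_sum => y _.
  by rewrite ler_piMl// sum_le1.
apply: le_trans IH.
rewrite [leRHS](eq_bigl (fun z => z \notin S)); last by move=> z; rewrite inE.
apply: ler_sum => z _; rewrite -mulr_sumr ler_piMr//.
  by apply: sumr_ge0 => x _; exact: t_step_ge0.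
rewrite -(P_sum z) [leRHS](bigID (mem (~: S)))/= lerDl.
by apply: sumr_ge0.
Qed.

(** Equal total masses make the surplus of [mu] on [S] equal to its deficit on the complement, which
    cancels the factor 1/2. *)
Lemma tv_distance_ge (mu nu : Omega -> R) (S : {set Omega}) :
  \sum_x mu x = \sum_x nu x ->
  \sum_(y in ~: S) nu y - \sum_(y in ~: S) mu y <= tv_distance mu nu.
Proof.
rewrite (bigID (mem S))/= [in RHS](bigID (mem S))/= => munu.
rewrite /tv_distance [in leRHS](bigID (mem S))/=.
have E (f : Omega -> R) : \sum_(y in ~: S) f y = \sum_(y | y \notin S) f y.
  by apply: eq_bigl => y; rewrite inE.
rewrite !E.
have h1 : \sum_(y | y \notin S) (nu y - mu y) <= \sum_(y | y \notin S) `|mu y - nu y|.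
  by apply: ler_sum => y _; rewrite distrC ler_norm.
have h2 : \sum_(y in S) (mu y - nu y) <= \sum_(y in S) `|mu y - nu y|.
  by apply: ler_sum => y _; rewrite ler_norm.
move: h1 h2; rewrite !sumrB; lra.
Qed.

(* A cut of small conductance is slow to cross: started uniformly in [S], the
   chain leaves [S] by time [t] with probability at most [t] times the ergodic
   flow out of [S], divided by the mass of [S]. *)
Lemma mixing_time_ge (pi : Omega -> R) (S : {set Omega}) (t : nat) :
  \sum_x pi x = 1 -> 2^-1 <= \sum_(y in ~: S) pi y ->
  t%:R * \sum_(z in S) \sum_(y in ~: S) P z y < #|S|%:R / 18 ->
  (t%:R%:E <= mixing_time P pi)%E.
Proof.
move=> pi1 piS flow.
have [x xS tvx] : exists2 x, x \in S & (expR 1)^-1 < tv_distance (t_step P t x) pi.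
  apply: contrapT => nex.
  (* If every start in [S] were mixed at time [t], each would put mass at least [1/2 - 4/9 = 1/18]
     outside [S]; summing over [S] contradicts [flow]. *)
  have {}nex x : x \in S -> 18^-1 <= \sum_(y in ~: S) t_step P t x y.
    move=> xS; have h : tv_distance (t_step P t x) pi <= (expR 1)^-1.
      by rewrite leNgt; apply/negP => h; apply: nex; exists x.
    have := @tv_distance_ge (t_step P t x) pi S; rewrite t_step_sum pi1 => /(_ erefl) h'.
    have : (expR 1)^-1 <= (9 / 4 : R)^-1.
      by rewrite lef_pV2 ?posrE ?expR_gt0 ?expR1_gt// divr_gt0.
    rewrite invf_div; lra.
  move: flow; apply/negP; rewrite -leNgt.
  apply: le_trans (t_step_escape S t); rewrite exchange_big/=.
  apply: (@le_trans _ _ (\sum_(x in S) 18^-1)); last by apply: ler_sum => x /nex.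
  by rewrite sumr_const -[leRHS]mulr_natl.
(* [mixed_after] concerns only times strictly beyond [t0], so failure at [t] forces [t <= t0]. *)
apply: le_trans (le_bigmax _ _ x); apply/ereal_infP => _ [t0 mix <-].
rewrite lee_fin ler_nat leqNgt; apply/negP => /mix.
by rewrite leNgt tvx.
Qed.

End SymmetricChain.

(** * Containers for sets of given neighbourhood *)

Section BipartiteRegular.
Context {T : finType}.
Variables (e : rel T) (Ev Od : {set T}) (d : nat).
Hypotheses (e_sym : symmetric e) (e_bip : bipartition e Ev Od).
Hypotheses (e_reg : d_regular e d) (d_gt0 : (0 < d)%N).

Local Notation nbh := (nbh e).
Local Notation nbhs_of := (nbhs_of e).
Local Notation closure_of := (closure_of e).

Implicit Types (A B S F X Y : {set T}).

Lemma mem_nbhsP A v : reflect (exists2 u, u \in A & e u v) (v \in nbhs_of A).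
Proof.
by apply: (iffP bigcupP) => -[u uA]; rewrite ?inE => uv; exists u; rewrite ?inE.
Qed.

Lemma nbhs_ofS A B : A \subset B -> nbhs_of A \subset nbhs_of B.
Proof.
move=> /subsetP AB; apply/subsetP => v /mem_nbhsP[u /AB uB uv].
by apply/mem_nbhsP; exists u.
Qed.

Lemma edge_double_count (A B : {set T}) :
  (\sum_(u in A) #|nbh u :&: B| = \sum_(v in B) #|nbh v :&: A|)%N.
Proof.
have E u (C : {set T}) : #|nbh u :&: C| = (\sum_(v in C) e u v)%N.
  rewrite -sum1_card big_mkcond [RHS]big_mkcond/=; apply: eq_bigr => v _.
  by rewrite !inE andbC; case: (v \in C); case: (e u v).
under eq_bigr do rewrite E; under [RHS]eq_bigr do rewrite E.
by rewrite exchange_big; apply: eq_bigr => v _; apply: eq_bigr => u _; rewrite e_sym.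
Qed.

Lemma mem_Od x : (x \in Od) = (x \notin Ev).
Proof.
have [EO dis _] := e_bip; have : x \in [set: T] by rewrite inE.
rewrite -EO inE; case: (boolP (x \in Ev)) => //= xE _.
by apply/negbTE; move: dis; rewrite disjoint_subset => /subsetP /(_ _ xE).
Qed.

Lemma edge_EvOd x y : e x y -> x \in Ev -> y \in Od.
Proof.
have [_ _ h] := e_bip; move=> /h; rewrite !mem_Od.
by case: (x \in Ev); case: (y \in Ev).
Qed.

Lemma edge_OdEv x y : e x y -> x \in Od -> y \in Ev.
Proof.
have [_ _ h] := e_bip; move=> /h; rewrite !mem_Od.
by case: (x \in Ev); case: (y \in Ev).
Qed.

Lemma nbh_sub_Od x : x \in Ev -> nbh x \subset Od.
Proof. by move=> xE; apply/subsetP => y; rewrite inE => /edge_EvOd; apply. Qed.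

Lemma nbhs_of_sub_Od A : A \subset Ev -> nbhs_of A \subset Od.
Proof.
move=> /subsetP AE; apply/subsetP => v /mem_nbhsP[u /AE uE uv].
exact: edge_EvOd uv uE.
Qed.

Lemma sub_closure A : A \subset closure_of A.
Proof.
apply/subsetP => x xA; rewrite inE; apply/subsetP => y; rewrite inE => xy.
by apply/mem_nbhsP; exists x.
Qed.

Lemma nbh_neq0 x : exists y, e x y.
Proof.
have /card_gt0P[y] : (0 < #|nbh x|)%N by rewrite e_reg.
by rewrite inE => xy; exists y.
Qed.

(** Positive degree matters: an isolated vertex would lie in every closure. *)
Lemma closure_sub_Ev A : A \subset Ev -> closure_of A \subset Ev.
Proof.
move=> AE; apply/subsetP => x; rewrite inE => /subsetP xA.
have [y xy] := nbh_neq0 x; have /xA/(subsetP (nbhs_of_sub_Od AE)) yO : y \in nbh x by rewrite inE.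
by apply: edge_OdEv yO; rewrite e_sym.
Qed.

Lemma nbhs_closure A : nbhs_of (closure_of A) = nbhs_of A.
Proof.
apply/eqP; rewrite eqEsubset [X in _ && X]nbhs_ofS ?sub_closure// andbT.
apply/subsetP => v /mem_nbhsP[u]; rewrite inE => /subsetP h uv; apply: h.
by rewrite inE.
Qed.

(** By regularity [d |A|] edges leave [A], and each vertex of [N(A)] receives at most [d] of
    them. *)
Lemma card_le_nbhs A : (#|A| <= #|nbhs_of A|)%N.
Proof.
rewrite -(leq_pmul2r d_gt0) -!sum_nat_const.
rewrite (eq_bigr (fun u => #|nbh u :&: nbhs_of A|)); last first.
  move=> u uA; rewrite -(e_reg u) (setIidPl _)//.
  by apply/subsetP => y; rewrite inE => uy; apply/mem_nbhsP; exists u.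
rewrite edge_double_count; apply: leq_sum => v _.
by rewrite -(e_reg v) subset_leq_card// subsetIl.
Qed.

Lemma closure_le_nbhs A : (#|closure_of A| <= #|nbhs_of A|)%N.
Proof. by rewrite -(nbhs_closure A) card_le_nbhs. Qed.

Lemma card_Ev_le_Od : (#|Ev| <= #|Od|)%N.
Proof. by apply: leq_trans (card_le_nbhs Ev) _; rewrite subset_leq_card// nbhs_of_sub_Od. Qed.

Section Containers.
Context {R : realType}.
Variable psi : R.
Hypothesis psi_gt0 : 0 < psi.
Hypothesis psi_le : 2 * psi <= d%:R.

(** Take a largest [Y] in [P] that covers at least [psi |Y|] vertices of [U]. A [w] with [psi]
    uncovered neighbours could be added to it. *)
Lemma greedy_cover (U P : {set T}) : exists Y : {set T},
  [/\ Y \subset P, psi * #|Y|%:R <= #|U|%:R &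
      forall w, w \in P -> #|(nbh w :&: U) :\: nbhs_of Y|%:R < psi].
Proof.
pose Q (Y : {set T}) := (Y \subset P) && (psi * #|Y|%:R <= #|U :&: nbhs_of Y|%:R).
have Q0 : Q finset.set0 by rewrite /Q sub0set cards0 mulr0 ler0n.
case: (arg_maxnP (fun Y : {set T} => #|Y|) Q0) => Y /andP[YP Ypsi] Ymax.
exists Y; split => //.
  by apply: (le_trans Ypsi); rewrite ler_nat subset_leq_card// subsetIl.
move=> w wP; rewrite ltNge; apply/negP => wpsi.
have UwY : #|U :&: nbhs_of (w |: Y)| =
    (#|(nbh w :&: U) :\: nbhs_of Y| + #|U :&: nbhs_of Y|)%N.
  rewrite -(cardsID (nbhs_of Y)) addnC; congr addn; apply: eq_card => v.
    rewrite !inE /nbhs_of bigcup_setU big_set1 !inE.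
    by case: (_ \in \bigcup_(_ in _) _); case: (v \in U); case: (e w v).
  rewrite !inE /nbhs_of bigcup_setU big_set1 !inE.
  by case: (_ \in \bigcup_(_ in _) _); case: (v \in U); case: (e w v).
have wY : w \notin Y.
  apply: contraTN wpsi => wY; rewrite -ltNge (_ : _ :\: _ = finset.set0) ?cards0//.
  apply/setP => v; rewrite !inE; apply/negP => /andP[/negP vY /andP[wv _]].
  by apply: vY; apply/mem_nbhsP; exists w.
have : Q (w |: Y).
  rewrite /Q subUset sub1set wP YP /= UwY cardsU1 wY !natrD mulrDr mulr1.
  by apply: lerD.
by move=> /Ymax; rewrite cardsU1 wY /= add1n ltnn.
Qed.

(** The set [S] of the container method, a function of [X] and [Y] alone, so that counting pairs
    suffices. When [Y] avoids [N(A)], deleting [nbhs_of Y] removes nothing from the closure of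
    [A]. *)
Definition outer_approx (X Y : {set T}) : {set T} :=
  [set u in Ev | #|nbh u :\: nbhs_of X|%:R < psi] :\: nbhs_of Y.

(** The set [F]: for the pairs built in [container_exists], the choice of [Y] forces a vertex of
    [Od] with [psi] neighbours in the outer set to lie in [N(A)]. *)
Definition inner_approx (X Y : {set T}) : {set T} :=
  nbhs_of X :|: [set v in Od | psi <= #|nbh v :&: outer_approx X Y|%:R].

Definition compatible (A S F : {set T}) : bool :=
  [&& closure_of A \subset S, F \subset nbhs_of A &
      d%:R * (#|S|%:R - #|F|%:R) <=
        4 * psi * (#|nbhs_of A|%:R - #|closure_of A|%:R) :> R].

(* Counting the edges between [S] and [N(A)] in two ways; the excesses
   [S :\: [A]] and [N(A) :\: F] are both controlled by the edges leaving
   [N(A)] outside [[A]]. *)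
Lemma approx_card (A S F : {set T}) :
  A \subset Ev -> closure_of A \subset S -> F \subset nbhs_of A ->
  (forall u, u \in S -> #|nbh u :\: F|%:R < psi) ->
  (forall v, v \in nbhs_of A :\: F -> #|nbh v :&: S|%:R < psi) ->
  d%:R * (#|S|%:R - #|F|%:R) <=
    4 * psi * (#|nbhs_of A|%:R - #|closure_of A|%:R) :> R.
Proof.
move=> AE CS FG hS hF.
set G := nbhs_of A in FG hF *; set C := closure_of A in CS *.
have card_nbhD v (D : {set T}) : #|nbh v :&: D|%:R + #|nbh v :\: D|%:R = d%:R :> R.
  by rewrite -natrD cardsID e_reg.
have eGC : \sum_(v in G) #|nbh v :&: C|%:R = d%:R * #|C|%:R :> R.
  rewrite -natr_sum -edge_double_count -natrM mulnC -sum_nat_const; congr _%:R.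
  apply: eq_bigr => u; rewrite inE => uG; rewrite -(e_reg u).
  by rewrite (setIidPl uG).
have eGnC : \sum_(v in G) #|nbh v :\: C|%:R = d%:R * (#|G|%:R - #|C|%:R) :> R.
  rewrite mulrBr -eGC mulr_natr -sumr_const -sumrB; apply: eq_bigr => v _.
  by rewrite -(card_nbhD v C) addrC addKr.
(* A vertex of [S] outside [C] sends at least [d - psi] edges into [F], hence into [G], while only
   [d (|G| - |C|)] edges from [G] avoid [C]. *)
have bndS : (d%:R - psi) * #|S :\: C|%:R <= d%:R * (#|G|%:R - #|C|%:R).
  rewrite -eGnC mulr_natr -sumr_const.
  apply: (@le_trans _ _ (\sum_(u in S :\: C) #|nbh u :&: G|%:R)).
    apply: ler_sum => u; rewrite inE => /andP[_ uS].
    have := hS u uS; have := card_nbhD u F.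
    have : #|nbh u :&: F|%:R <= #|nbh u :&: G|%:R :> R.
      by rewrite ler_nat subset_leq_card// setIS.
    lra.
  rewrite -natr_sum edge_double_count natr_sum; apply: ler_sum => v _.
  by rewrite ler_nat subset_leq_card// setIDA setSD// subsetIl.
have bndF : (d%:R - psi) * #|G :\: F|%:R <= d%:R * (#|G|%:R - #|C|%:R).
  rewrite -eGnC mulr_natr -sumr_const.
  apply: (@le_trans _ _ (\sum_(v in G :\: F) #|nbh v :\: C|%:R)).
    apply: ler_sum => v vGF; have := hF v vGF; have := card_nbhD v C.
    have : #|nbh v :&: C|%:R <= #|nbh v :&: S|%:R :> R.
      by rewrite ler_nat subset_leq_card// setIS.
    lra.
  rewrite [leRHS](bigID (mem F))/= addrC.
  rewrite [leLHS](eq_bigl (fun v => (v \in G) && (v \notin F))).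
    by rewrite lerDl sumr_ge0.
  by move=> v; rewrite !inE andbC.
(* Edges between [S] and [G]: vertices of [C] send all [d], the rest of [S] at least [d - psi];
   vertices of [F] receive at most [d], those of [G :\: F] at most [psi]. *)
have cnt : d%:R * #|S|%:R - psi * #|S :\: C|%:R <= d%:R * #|F|%:R + psi * #|G :\: F|%:R.
  have -> : #|S|%:R = #|C|%:R + #|S :\: C|%:R :> R.
    by rewrite -natrD -(cardsID C S) (setIidPr CS).
  apply: (@le_trans _ _ (\sum_(u in S) #|nbh u :&: G|%:R)).
    rewrite (big_setID C)/= (setIidPr CS) mulrDr -addrA -mulrBl; apply: lerD.
      rewrite mulr_natr -sumr_const; apply: ler_sum => u; rewrite inE => uG.
      by rewrite -(e_reg u) (setIidPl uG).
    rewrite mulr_natr -sumr_const; apply: ler_sum => u; rewrite inE => /andP[_ uS].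
    have := hS u uS; have := card_nbhD u F.
    have : #|nbh u :&: F|%:R <= #|nbh u :&: G|%:R :> R.
      by rewrite ler_nat subset_leq_card// setIS.
    lra.
  rewrite -natr_sum edge_double_count natr_sum (big_setID F)/= (setIidPr FG).
  apply: lerD; rewrite mulr_natr -sumr_const; apply: ler_sum => v vF.
    by rewrite -(e_reg v) ler_nat subset_leq_card// subsetIl.
  exact/ltW/hF.
(* [2 psi <= d] allows [d - psi] to be replaced by [d / 2]. *)
have half (x t : R) : 0 <= x -> (d%:R - psi) * x <= d%:R * t -> x <= 2 * t.
  have d0 : 0 < d%:R :> R by rewrite ltr0n.
  move=> x0 h; suff : d%:R * x <= d%:R * (2 * t) by rewrite ler_pM2l.
  by have := ler_wpM2r x0 psi_le; lra.
have hS' := ler_wpM2l (ltW psi_gt0) (half _ _ (ler0n _ _) bndS).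
have hF' := ler_wpM2l (ltW psi_gt0) (half _ _ (ler0n _ _) bndF).
lra.
Qed.

(** Two greedy rounds: [X] inside the closure covers most of each neighbourhood of a closure vertex;
    then [Y] off [N(A)] removes the candidates in [S1] that have too many edges leading outside
    [N(A)]. *)
Lemma container_exists (A : {set T}) : A \subset Ev -> exists X Y : {set T},
  [/\ psi * #|X|%:R <= #|Od|%:R, psi * #|Y|%:R <= #|Ev|%:R &
      compatible A (outer_approx X Y) (inner_approx X Y)].
Proof.
move=> AE.
have [X [XC Xpsi hX]] := greedy_cover Od (closure_of A).
pose S1 := [set u in Ev | #|nbh u :\: nbhs_of X|%:R < psi].
have [Y [YO Ypsi hY]] := greedy_cover S1 (Od :\: nbhs_of A).
exists X, Y; split => //.
  apply: (le_trans Ypsi); rewrite ler_nat subset_leq_card//.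
  by apply/subsetP => u; rewrite inE => /andP[].
have CS : closure_of A \subset outer_approx X Y.
  apply/subsetP => u uC; have uE := subsetP (closure_sub_Ev AE) u uC.
  rewrite !inE uE /=; apply/andP; split.
    apply/mem_nbhsP => -[w /(subsetP YO)]; rewrite inE => /andP[/negP wG _] wu.
    apply: wG; move: uC; rewrite inE => /subsetP; apply.
    by rewrite inE e_sym.
  by have := hX u uC; rewrite (setIidPl (nbh_sub_Od uE)).
have FG : inner_approx X Y \subset nbhs_of A.
  rewrite subUset -(nbhs_closure A) nbhs_ofS//=.
  apply/subsetP => v; rewrite inE => /andP[vO]; rewrite nbhs_closure.
  apply: contraTT => vG; rewrite -ltNge.
  have := hY v; rewrite inE vG vO => /(_ isT).
  by rewrite setIDA.
rewrite /compatible CS FG /=.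
apply: approx_card => //.
  move=> u; rewrite !inE => /andP[_ /andP[_]]; apply: le_lt_trans.
  by rewrite ler_nat subset_leq_card// setDS// subsetUl.
move=> v; rewrite inE => /andP[]; rewrite !inE negb_or => /andP[_ vF].
move=> /(subsetP (nbhs_of_sub_Od AE)) vO.
by move: vF; rewrite vO /= -ltNge.
Qed.

(** There are only [2 ^ |S|] candidates for [A], which cancels the weight [2 ^ (- |S|)]. *)
Lemma sum_powR2_subsets (S : {set T}) (Q : pred {set T}) (w : {set T} -> R) (c : R) :
  (forall A, Q A -> A \subset S) -> (forall A, Q A -> w A <= c * 2 `^ (- #|S|%:R)) ->
  0 <= c -> \sum_(A | Q A) w A <= c.
Proof.
move=> QS wc c0; have cS : 0 <= c * 2 `^ (- #|S|%:R) by rewrite mulr_ge0 ?powR_ge0.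
apply: (@le_trans _ _ (\sum_(A in powerset S) c * 2 `^ (- #|S|%:R))).
  rewrite big_mkcond [leRHS]big_mkcond; apply: ler_sum => A _; rewrite powersetE.
  case: ifPn => [QA|_]; last by case: ifP.
  by rewrite QS// wc.
rewrite sumr_const card_powerset -[leLHS]mulr_natr -mulrA -powR2_nat -powR2D.
by rewrite addNr powRr0 mulr1.
Qed.

(* If [N(A)] exceeds [F] by a lot, then [S] is much smaller than [N(A)] and
   [A] is specified as a subset of [S]. Otherwise [N(A)] is cheaply specified by
   [W = N(A) :\: F], and then [A] as a subset of [[A]]. *)
Lemma sum_compatible (S F : {set T}) (Q : pred {set T}) (tau L : R) :
  0 <= L -> 16 * psi * L <= d%:R ->
  (forall A, Q A -> tau <= #|nbhs_of A|%:R - #|closure_of A|%:R) ->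
  \sum_(A | Q A && compatible A S F) 2 `^ (- #|nbhs_of A|%:R) <=
    2 `^ (- (4 * psi / d%:R * tau)) + 2 `^ (2 * #|T|%:R * 2 `^ (- L) - tau / 2).
Proof.
move=> L0 psiL Qtau.
have d0 : 0 < d%:R :> R by rewrite ltr0n.
set k := psi / d%:R; have psiE : psi = k * d%:R by rewrite divfK// gt_eqF.
have k0 : 0 < k by rewrite divr_gt0.
have kL : 16 * k * L <= 1.
  by rewrite -(ler_pM2r d0) mul1r (le_trans _ psiL)// psiE; lra.
have -> : 4 * psi / d%:R * tau = 4 * k * tau by rewrite /k; ring.
have compE A : compatible A S F -> [/\ closure_of A \subset S, F \subset nbhs_of A &
    #|S|%:R - #|F|%:R <= 4 * k * (#|nbhs_of A|%:R - #|closure_of A|%:R) :> R].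
  case/and3P => CS FG h; split => //; rewrite -(ler_pM2l d0); apply: le_trans h _.
  by rewrite {1}psiE; lra.
rewrite (bigID (fun A => 8 * k * (#|nbhs_of A|%:R - #|closure_of A|%:R) <=
                         #|nbhs_of A :\: F|%:R))/=.
apply: lerD.
  apply: (@sum_powR2_subsets S); last exact: powR_ge0.
    move=> A /andP[/andP[_ /compE[CS _ _]] _].
    exact: fintype.subset_trans (sub_closure A) CS.
  (* With [t] the excess of [A], [|S| <= |F| + 4 k t] and [|F| <= |N(A)| - 8 k t], so
     [|S| <= |N(A)| - 4 k t]. *)
  move=> A /andP[/andP[QA /compE[CS FG h1]] h2]; rewrite -powR2D; apply: ler_powR2.
  have : #|nbhs_of A|%:R = #|F|%:R + #|nbhs_of A :\: F|%:R :> R.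
    by rewrite -natrD -(cardsID F (nbhs_of A)) (setIidPr FG).
  by have := Qtau A QA; nra.
have setUDK (G : {set T}) : F \subset G -> F :|: (G :\: F) = G.
  by move=> FG; rewrite -{1}(setIidPr FG) setID.
rewrite addrC powR2D.
rewrite (partition_big (fun A => nbhs_of A :\: F) xpredT)//=.
apply: le_trans (ler_wpM2l (powR_ge0 _ _) (sum_subset_powR2 T L)).
rewrite mulr_sumr; apply: ler_sum => W _; rewrite -powR2D.
(* Once [W] is fixed, [F :|: W] is [N(A)], so this ambient set is the closure of [A]. *)
apply: (@sum_powR2_subsets [set x | nbh x \subset F :|: W]); last exact: powR_ge0.
  move=> A /andP[/andP[/andP[_ /compE[_ FG _]] _] /eqP <-].
  by rewrite setUDK// sub_closure.
move=> A /andP[/andP[/andP[QA /compE[_ FG _]] h2] /eqP WE].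
rewrite -{2}WE setUDK// -/(closure_of A) -powR2D; apply: ler_powR2.
move: h2; rewrite -ltNge WE => h2; have := Qtau A QA.
(* From [|W| < 8 k t] and [16 k L <= 1]: naming [W] costs at most half of the gain [t]. *)
have : L * #|W|%:R <= (#|nbhs_of A|%:R - #|closure_of A|%:R) / 2; last by lra.
have := ler_wpM2l L0 (ltW h2).
by have : 0 < #|nbhs_of A|%:R - #|closure_of A|%:R :> R; [have := ler0n R #|W|; nra|nra].
Qed.

(** Union bound over the pairs [(X, Y)]; the first factor on the right bounds their number. *)
Lemma sum_containers (Q : pred {set T}) (tau L : R) :
  0 <= L -> 16 * psi * L <= d%:R -> (forall A, Q A -> A \subset Ev) ->
  (forall A, Q A -> tau <= #|nbhs_of A|%:R - #|closure_of A|%:R) ->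
  \sum_(A | Q A) 2 `^ (- #|nbhs_of A|%:R) <=
    2 `^ (L * (#|Ev|%:R + #|Od|%:R) / psi + 4 * #|T|%:R * 2 `^ (- L)) *
    (2 `^ (- (4 * psi / d%:R * tau)) + 2 `^ (2 * #|T|%:R * 2 `^ (- L) - tau / 2)).
Proof.
move=> L0 psiL QE Qtau.
pose K (D : {set T}) : {set {set T}} := [set X : {set T} | psi * #|X|%:R <= #|D|%:R].
pose approx (XY : {set T} * {set T}) A :=
  compatible A (outer_approx XY.1 XY.2) (inner_approx XY.1 XY.2).
apply: (@le_trans _ _ (\sum_(XY in setX (K Od) (K Ev))
    \sum_(A | Q A && approx XY A) 2 `^ (- #|nbhs_of A|%:R))).
  under [leRHS]eq_bigr do rewrite big_mkcondr.
  rewrite exchange_big/=; apply: ler_sum => A QA.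
  have [X [Y [Xpsi Ypsi comp]]] := container_exists (QE A QA).
  rewrite (bigD1 (X, Y))/=; last by rewrite !inE Xpsi Ypsi.
  rewrite /approx/= comp lerDl; apply: sumr_ge0 => XY _; by case: ifP.
apply: (@le_trans _ _ (\sum_(XY in setX (K Od) (K Ev))
    (2 `^ (- (4 * psi / d%:R * tau)) + 2 `^ (2 * #|T|%:R * 2 `^ (- L) - tau / 2)))).
  by apply: ler_sum => XY _; exact: sum_compatible.
rewrite sumr_const cardsX -[leLHS]mulr_natl ler_wpM2r ?addr_ge0 ?powR_ge0//.
have -> : L * (#|Ev|%:R + #|Od|%:R) / psi + 4 * #|T|%:R * 2 `^ (- L) =
    (L * #|Od|%:R / psi + 2 * #|T|%:R * 2 `^ (- L)) +
    (L * #|Ev|%:R / psi + 2 * #|T|%:R * 2 `^ (- L)) by ring.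
by rewrite powR2D natrM; apply: ler_pM; rewrite ?ler0n// card_small_subsets.
Qed.

End Containers.

(** * Counting balanced independent sets *)

Lemma card_bip : (#|Ev| + #|Od| = #|T|)%N.
Proof.
rewrite -(cardsC Ev); congr addn; apply: eq_card => x.
by rewrite mem_Od inE.
Qed.

(** Once [A = I :&: Ev] is fixed, [I] is determined by [I :&: Od], a subset of [Od :\: N(A)]. *)
Lemma card_indep_fiber (R : realType) (Q : pred {set T}) :
  (forall A, Q A -> A \subset Ev) ->
  #|[set I : {set T} | independent e I && Q (I :&: Ev)]|%:R <=
    2 `^ #|Od|%:R * \sum_(A | Q A) 2 `^ (- #|nbhs_of A|%:R) :> R.
Proof.
move=> QE; rewrite mulr_sumr -sum1_card.
rewrite (partition_big (fun I => I :&: Ev) Q)/=; last by move=> I; rewrite inE => /andP[].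
rewrite natr_sum; apply: ler_sum => A QA; rewrite sum1dep_card -powR2D.
have -> : #|Od|%:R - #|nbhs_of A|%:R = #|Od :\: nbhs_of A|%:R :> R.
  rewrite -(cardsID (nbhs_of A) Od) natrD (setIidPr (nbhs_of_sub_Od (QE A QA))).
  by rewrite addrAC subrr add0r.
rewrite powR2_nat ler_nat -card_powerset.
have inj : {in [set I | (I \in [set I : {set T} | independent e I && Q (I :&: Ev)]) &&
    (I :&: Ev == A)] &, injective (fun I : {set T} => I :&: Od)}.
  move=> I J; rewrite !inE => /andP[_ /eqP IA] /andP[_ /eqP JA] IJ.
  apply/setP => x; have := congr1 (fun B : {set T} => x \in B) IJ.
  have := congr1 (fun B : {set T} => x \in B) (etrans IA (esym JA)).
  by rewrite !inE mem_Od; case: (x \in Ev); rewrite ?andbT ?andbF.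
rewrite -(card_in_imset inj); apply: subset_leq_card.
apply/subsetP => _ /imsetP[I + ->]; rewrite !inE => /andP[/andP[ind _] /eqP IA].
apply/subsetP => x; rewrite !inE => /andP[xI ->]; rewrite andbT.
apply/mem_nbhsP => -[u]; rewrite -IA inE => /andP[uI _] ux.
by move/forall_inP: ind => /(_ u uI)/forall_inP/(_ x xI); rewrite ux.
Qed.

Definition heavy (A : {set T}) : bool := small_in e Ev A && (#|Ev| < 32 * #|A|)%N.

(** [L = log2 d] turns [2 ^ (- L)] into [1 / d], and [psi] is chosen so that [16 psi L = d].
    Heaviness and expansion give excess at least [delta M / 32]. Each summand of [sum_containers]
    pays for one of the two copies on the right. *)
Lemma card_indep_heavy (R : realType) (delta : R) :
  (2 <= d)%N -> #|Ev| = #|Od| -> 0 <= delta ->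
  40 * 256 * log2 (d%:R : R) ^+ 3 / d%:R <= delta ->
  (forall A, A != finset.set0 -> small_in e Ev A ->
     delta * #|nbhs_of A|%:R <= #|nbhs_of A|%:R - #|closure_of A|%:R) ->
  #|[set I : {set T} | independent e I && heavy (I :&: Ev)]|%:R <=
    2 * 2 `^ (#|Ev|%:R - delta * #|Ev|%:R / (256 * log2 d%:R)) :> R.
Proof.
move=> d2 EO delta0 hd hexp.
have l1 : 1 <= log2 (d%:R : R) := log2_ge1 R d2.
set l := log2 _ in hd l1 *; have l0 : 0 < l by lra.
have d0 : 0 < d%:R :> R by rewrite ltr0n.
set psi : R := d%:R / (16 * l).
have psi0 : 0 < psi by rewrite divr_gt0// mulr_gt0.
have psiE : d%:R = 16 * psi * l by rewrite /psi; field; rewrite gt_eqF.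
have psi_le : 2 * psi <= d%:R by rewrite psiE; nra.
have heavyE A : heavy A -> A \subset Ev by case/andP => /andP[].
apply: (le_trans (card_indep_fiber R heavyE)); rewrite -EO powR2D mulrCA ler_wpM2l ?powR_ge0//.
set M := #|Ev|%:R : R.
have tauP A : heavy A -> delta * M / 32 <= #|nbhs_of A|%:R - #|closure_of A|%:R.
  move=> /andP[sA MA]; apply: le_trans (hexp A _ sA).
    rewrite -mulrA ler_wpM2l// ler_pdivrMr// mulrC -natrM ler_nat.
    by rewrite (leq_trans (ltnW MA))// leq_mul2l card_le_nbhs.
  by apply: contraTneq MA => ->; rewrite cards0 muln0.
apply: le_trans (sum_containers psi0 psi_le (ltW l0) _ heavyE tauP) _; first by rewrite -psiE.
have -> : #|T|%:R = 2 * M by rewrite -card_bip -EO natrD /M; ring.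
rewrite -EO -/M powRN powR2_log2//.
have [h1 h2] := heavy_exponent l1 d0 (ler0n R #|Ev|) hd.
rewrite mulrDr -!powR2D [leRHS]mulr_natl [leRHS]mulr2n.
have -> : l * (M + M) / psi + 4 * (2 * M) / d%:R = 32 * M * l ^+ 2 / d%:R + 8 * M / d%:R.
  by rewrite /psi; field; rewrite !gt_eqF.
apply: lerD; apply: ler_powR2.
  have -> : 4 * psi / d%:R * (delta * M / 32) = 2 * (delta * M / (256 * l)).
    by rewrite /psi; field; rewrite !gt_eqF.
  by move: h1; rewrite -/M; lra.
move: h2; rewrite -/M.
have -> : 2 * (2 * M) / d%:R = 4 * M / d%:R by ring.
have -> : delta * M / 32 / 2 = delta * M / 64 by field.
lra.
Qed.

End BipartiteRegular.

Lemma bipartitionC (T : finType) (e : rel T) (Ev Od : {set T}) :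
  bipartition e Ev Od -> bipartition e Od Ev.
Proof.
case=> EO dis h; split; first by rewrite setUC.
  by rewrite disjoint_sym.
by move=> x y /h; rewrite orbC.
Qed.

Lemma card_bip_eq (T : finType) (e : rel T) (Ev Od : {set T}) (d : nat) :
  symmetric e -> bipartition e Ev Od -> d_regular e d -> (0 < d)%N -> #|Ev| = #|Od|.
Proof.
move=> e_sym bip e_reg d0; apply/eqP; rewrite eqn_leq.
rewrite (card_Ev_le_Od e_sym bip e_reg d0).
by rewrite (card_Ev_le_Od e_sym (bipartitionC bip) e_reg d0).
Qed.

(* [[I :&: Od]] and [N(I :&: Ev)] are disjoint, and the latter is at least as
   large as [[I :&: Ev]]. *)
Lemma independent_small (T : finType) (e : rel T) (Ev Od I : {set T}) (d : nat) :
  symmetric e -> bipartition e Ev Od -> d_regular e d -> (0 < d)%N ->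
  independent e I -> small_in e Ev (I :&: Ev) || small_in e Od (I :&: Od).
Proof.
move=> e_sym bip e_reg d0 ind; have EO := card_bip_eq e_sym bip e_reg d0.
have le1 := closure_le_nbhs e_sym e_reg d0 (I :&: Ev).
have sub1 := nbhs_of_sub_Od bip (subsetIr I Ev).
have sub2 := closure_sub_Ev e_sym (bipartitionC bip) e_reg d0 (subsetIr I Od).
have dis : closure_of e (I :&: Od) :&: nbhs_of e (I :&: Ev) = finset.set0.
  apply/setP => x; rewrite !inE; apply/negP => /andP[/fintype.subsetP h].
  move=> /mem_nbhsP[u]; rewrite inE => /andP[uI _] ux.
  have /h/mem_nbhsP[w] : u \in nbh e x by rewrite inE e_sym.
  rewrite inE => /andP[wI _] wu.
  by move/forall_inP: ind => /(_ w wI)/forall_inP/(_ u uI); rewrite wu.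
have : (#|closure_of e (I :&: Od)| + #|nbhs_of e (I :&: Ev)| <= #|Od|)%N.
  by rewrite -cardsUI dis cards0 addn0 subset_leq_card// subUset sub1 sub2.
rewrite /small_in !subsetIr /= EO.
by move: le1; clear; lia.
Qed.

(** The two traces of a balanced set have equal size, so either both are light or both exceed
    [M / 32], and then a small one is heavy. The factor 5 is 1 for the light pairs plus 2 for each
    class. *)
Lemma card_balanced (R : realType) (T : finType) (e : rel T) (Ev Od : {set T})
    (d : nat) (delta : R) :
  symmetric e -> bipartition e Ev Od -> d_regular e d -> (2 <= d)%N ->
  0 <= delta <= 1 -> 40 * 256 * log2 (d%:R : R) ^+ 3 / d%:R <= delta ->
  (forall A, A != finset.set0 -> small_in e Ev A || small_in e Od A ->
     delta * #|nbhs_of e A|%:R <= #|nbhs_of e A|%:R - #|closure_of e A|%:R) ->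
  #|[set I : {set T} | independent e I && (#|I :&: Ev| == #|I :&: Od|)]|%:R <=
    5 * 2 `^ (#|Ev|%:R - delta * #|Ev|%:R / (256 * log2 d%:R)) :> R.
Proof.
move=> e_sym bip e_reg d2 /andP[delta0 delta1] hd hexp.
have d0 : (0 < d)%N by exact: ltnW.
have EO := card_bip_eq e_sym bip e_reg d0.
pose light := [set A : {set T} | (32 : R) * #|A|%:R <= #|Ev|%:R].
pose BL := [set I : {set T} | (I :&: Ev \in light) && (I :&: Od \in light)].
pose BE := [set I : {set T} | independent e I && heavy e Ev (I :&: Ev)].
pose BO := [set I : {set T} | independent e I && heavy e Od (I :&: Od)].
have lightE A : (A \in light) = ~~ (#|Ev| < 32 * #|A|)%N.
  by rewrite inE -natrM ler_nat -leqNgt.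
have cover : [set I : {set T} | independent e I && (#|I :&: Ev| == #|I :&: Od|)]
    \subset BL :|: BE :|: BO.
  apply/fintype.subsetP => I; rewrite inE => /andP[ind /eqP bal].
  rewrite !in_setU [I \in BL]inE [I \in BE]inE [I \in BO]inE !lightE ind /heavy -EO -bal.
  have := independent_small e_sym bip e_reg d0 ind.
  by case: (_ < _)%N => //=; rewrite !andbT.
have cardBE := card_indep_heavy e_sym bip e_reg d0 d2 EO delta0 hd.
have cardBO := card_indep_heavy e_sym (bipartitionC bip) e_reg d0 d2 (esym EO) delta0 hd.
have {}cardBE := cardBE (fun A A0 sA => hexp A A0 (introT orP (or_introl sA))).
have {}cardBO := cardBO (fun A A0 sA => hexp A A0 (introT orP (or_intror sA))).
set l := log2 _ in hd cardBE cardBO *.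
have l1 : 1 <= l := log2_ge1 R d2.
(* With [L = 4] and [psi = 32] the exponent is [M / 8 + M / 4]; two light traces then cost
   [3 M / 4], well below [M - M / 256]. *)
have cardL : #|light|%:R <= 2 `^ (3 / 8 * #|Ev|%:R) :> R.
  have /le_trans -> // := @card_small_subsets R T 4 32 #|Ev|%:R (ler0n _ _) (ltr0Sn _ _).
  apply: ler_powR2; rewrite -(card_bip bip) -EO natrD.
  by rewrite powRN powR_mulrn//; lra.
have cardBL : #|BL|%:R <= 2 `^ (#|Ev|%:R - delta * #|Ev|%:R / (256 * l)) :> R.
  apply: (@le_trans _ _ (#|light| * #|light|)%:R).
    rewrite ler_nat -cardsX.
    have inj : injective (fun I : {set T} => (I :&: Ev, I :&: Od)).
      move=> I J [IE IO]; apply/setP => x.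
      move/setP: IE => /(_ x); move/setP: IO => /(_ x); rewrite !inE (mem_Od bip).
      by case: (x \in Ev); rewrite ?andbT ?andbF.
    rewrite -(card_imset _ inj); apply: subset_leq_card.
    by apply/fintype.subsetP => _ /imsetP[I + ->]; rewrite !inE.
  rewrite natrM; apply: (le_trans (ler_pM (ler0n _ _) (ler0n _ _) cardL cardL)).
  rewrite -powR2D; apply: ler_powR2.
  have M0 : 0 <= #|Ev|%:R :> R by [].
  have : delta * #|Ev|%:R / (256 * l) <= #|Ev|%:R / 256.
    rewrite invfM mulrA ler_pdivrMr; last by lra.
    by rewrite mulrAC -[leRHS]mulrA [leRHS]mulrCA; nra.
  by lra.
have : (#|[set I : {set T} | independent e I && (#|I :&: Ev| == #|I :&: Od|)]|
    <= #|BL| + #|BE| + #|BO|)%N.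
  apply: leq_trans (subset_leq_card cover) _.
  apply: leq_trans (leq_of_leqif (leq_card_setU _ _)) _.
  by rewrite leq_add2r; exact: leq_of_leqif (leq_card_setU _ _).
rewrite -(ler_nat R) !natrD -/BE -/BO.
move: cardBE cardBO; rewrite -/BE -/BO -EO; lra.
Qed.

(** * Glauber dynamics *)

Section Glauber.
Context {R : realType} {T : finType}.
Variable e : rel T.

Lemma symdiffC (A B : {set T}) : symdiff A B = symdiff B A.
Proof. by rewrite /symdiff setUC. Qed.

Lemma symdiff_inj (A : {set T}) : injective (symdiff A).
Proof.
move=> B C /setP BC; apply/setP => x; have := BC x; rewrite !inE.
by case: (x \in A); case: (x \in B); case: (x \in C).
Qed.

Lemma symdiff_eq0 (A B : {set T}) : (#|symdiff A B| == 0)%N = (A == B).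
Proof. by rewrite cards_eq0 setU_eq0 !setD_eq0 eqEsubset. Qed.

(** At activity 1 insertions and deletions have the same rate, which makes the chain symmetric. *)
Lemma glauber_move1E (I J : indep_set e) : glauber_move (1 : R) I J =
  if (1 < #|symdiff (val I) (val J)|)%N then 0 else #|T|%:R^-1 * 2^-1.
Proof. by rewrite /glauber_move; case: ifP => // _; case: ifP; rewrite div1r. Qed.

Lemma glauber_move1_ge0 (I J : indep_set e) : 0 <= glauber_move (1 : R) I J.
Proof. by rewrite glauber_move1E; case: ifP => // _; rewrite mulr_ge0. Qed.

Lemma glauber_move1_sum (I : indep_set e) :
  \sum_(J : indep_set e | J != I) glauber_move (1 : R) I J <= 1.
Proof.
pose nb := [set J : indep_set e | (J != I) && (#|symdiff (val I) (val J)| <= 1)%N].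
have card_nb : (#|nb| <= #|T|)%N.
  (* Neighbours of [I] inject into the singletons through their symmetric difference with [I]. *)
  have inj : injective (fun J : indep_set e => symdiff (val I) (val J)).
    by move=> J K /symdiff_inj/val_inj.
  rewrite -(card_imset _ inj) -[leqRHS]bin1 -card_draws; apply: subset_leq_card.
  apply/fintype.subsetP => _ /imsetP[J + ->]; rewrite !inE => /andP[JI le1].
  rewrite eqn_leq le1 lt0n symdiff_eq0; apply: contra JI => /eqP IJ.
  by rewrite eq_sym; apply/eqP/val_inj.
apply: (@le_trans _ _ (\sum_(J in nb) #|T|%:R^-1 * 2^-1)).
  rewrite big_mkcond [leRHS]big_mkcond; apply: ler_sum => J _.
  by rewrite inE glauber_move1E ltnNge; case: (J != I); case: (_ <= _)%N.
rewrite sumr_const -[leLHS]mulr_natl mulrA -[leRHS]mulr1.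
apply: ler_pM => //; last by rewrite invf_le1// ler1n.
have [->|T0] := posnP #|T|; first by rewrite invr0 mulr0.
by rewrite ler_pdivrMr ?ltr0n// mul1r ler_nat.
Qed.

Lemma glauber1_ge0 (I J : indep_set e) : 0 <= glauber (1 : R) I J.
Proof.
rewrite /glauber; case: ifP => _; last exact: glauber_move1_ge0.
by rewrite subr_ge0 glauber_move1_sum.
Qed.

Lemma glauber1_sum (I : indep_set e) : \sum_J glauber (1 : R) I J = 1.
Proof.
rewrite (bigD1 I)//= {1}/glauber eqxx.
rewrite [X in _ + X](eq_bigr (fun J => glauber_move (1 : R) I J)) ?subrK//.
by move=> J /negPf JI; rewrite /glauber JI.
Qed.

Lemma glauber1_sym (I J : indep_set e) : glauber (1 : R) I J = glauber (1 : R) J I.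
Proof.
rewrite /glauber eq_sym; case: eqP => [->//|_].
by rewrite !glauber_move1E symdiffC.
Qed.

Lemma hard_core1_sum (A : {set indep_set e}) :
  \sum_(I in A) hard_core (1 : R) I = #|A|%:R / #|{: indep_set e}|%:R.
Proof.
rewrite -[#|A|]sum1_card natr_sum mulr_suml; apply: eq_bigr => I _.
rewrite /hard_core expr1n; congr (_ / _); rewrite -sum1_card natr_sum.
by apply: eq_bigr => J _; rewrite expr1n.
Qed.

(* A single-site update changes [#|I :&: Ev| - #|I :&: Od|] by at most one, so it
   can only leave [S] through a balanced set. *)
Lemma glauber1_flow (Ev Od : {set T}) (S B : {set indep_set e}) :
  S = [set I | (#|val I :&: Od| < #|val I :&: Ev|)%N] ->
  B = [set I | #|val I :&: Ev| == #|val I :&: Od|] ->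
  \sum_(I in S) \sum_(J in ~: S) glauber (1 : R) I J <= #|B|%:R.
Proof.
move=> SE BE; rewrite exchange_big/=.
apply: (@le_trans _ _ (\sum_(J in B) 1)); last by rewrite sumr_const.
rewrite big_mkcond [leRHS]big_mkcond; apply: ler_sum => J _.
case: ifPn => [JS|_]; last by case: ifP.
case: ifPn => [_|JB].
  (* By symmetry the flow into a balanced [J] is part of its own row, whose sum is 1. *)
  under eq_bigr do rewrite glauber1_sym.
  rewrite -[leRHS](glauber1_sum J) [leRHS](bigID (mem S))/= lerDl.
  by apply: sumr_ge0 => I _; exact: glauber1_ge0.
rewrite big1// => I IS; rewrite /glauber; case: eqP => [JI|_].
  by move: JS; rewrite JI inE IS.
rewrite glauber_move1E; case: ltnP => // le1; exfalso.
move: JS JB IS; rewrite SE BE !inE -leqNgt => JS JB IS.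
(* With [J] unbalanced, the surplus of [Ev] over [Od] drops from at least 1 to at most -1, yet the
   vertices that lower it form disjoint pieces of a symmetric difference of size at most 1. *)
have sub : (#|(val I :&: Ev) :\: val J| + #|(val J :&: Od) :\: val I| <= 1)%N.
  apply: leq_trans le1; rewrite /symdiff cardsU.
  rewrite (_ : (_ :\: _) :&: _ = finset.set0) ?cards0 ?subn0; last first.
    by apply/setP => x; rewrite !inE; case: (x \in val I); rewrite ?andbF.
  by apply: leq_add; apply: subset_leq_card; rewrite setSD// subsetIl.
have h1 : (#|val I :&: Ev| <= #|val J :&: Ev| + #|(val I :&: Ev) :\: val J|)%N.
  rewrite -[leqLHS](cardsID (val J)) leq_add2r subset_leq_card//.
  by apply/fintype.subsetP => x; rewrite !inE => /andP[/andP[_ ->] ->].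
have h2 : (#|val J :&: Od| <= #|val I :&: Od| + #|(val J :&: Od) :\: val I|)%N.
  rewrite -[leqLHS](cardsID (val I)) leq_add2r subset_leq_card//.
  by apply/fintype.subsetP => x; rewrite !inE => /andP[/andP[_ ->] ->].
by move/eqP: JB; move: JS IS sub h1 h2; do 6![move: #|_| => ?]; lia.
Qed.

End Glauber.

(** * Dominated families and the lower bound on the mixing time *)

Lemma indep_sub_class (T : finType) (e : rel T) (Ev Od A : {set T}) :
  bipartition e Ev Od -> A \subset Ev -> independent e A.
Proof.
move=> bip /fintype.subsetP AE; apply/forall_inP => x /AE xE; apply/forall_inP => y /AE yE.
by apply/negP => /(edge_EvOd bip)/(_ xE); rewrite (mem_Od bip) yE.
Qed.

(** The nonempty subsets of [Ev] suffice: there are [2 ^ |Ev| - 1] of them. *)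
Lemma card_indep_gt (T : finType) (e : rel T) (Ev Od : {set T}) :
  bipartition e Ev Od -> (0 < #|Ev|)%N ->
  (2 ^ #|Ev|.-1 <= #|[set I : indep_set e | (#|val I :&: Od| < #|val I :&: Ev|)%N]|)%N.
Proof.
move=> bip Ev0; set S := [set I | _].
have sub : powerset Ev :\ finset.set0 \subset [set val I | I in S].
  apply/fintype.subsetP => A; rewrite !inE => /andP[A0 AE].
  apply/imsetP; exists (exist _ A (indep_sub_class bip AE)) => //.
  rewrite inE /= (setIidPl AE) (_ : A :&: Od = finset.set0) ?cards0 ?card_gt0//.
  apply/setP => x; rewrite !inE (mem_Od bip).
  by case: (boolP (x \in A)) => //= /(fintype.subsetP AE) ->.
rewrite -(card_imset _ val_inj); apply: leq_trans (subset_leq_card sub).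
have := cardsD1 finset.set0 (powerset Ev); rewrite powersetE sub0set card_powerset.
move: #|_ :\ _| => m; case: #|Ev| Ev0 => //= n _; rewrite expnS.
by have := expn_gt0 2 n; lia.
Qed.

(** This is where [N >= d ^ 2] enters: the exponent becomes large enough to absorb the numerical
    constants of the bottleneck bound. *)
Lemma exponent_large (R : realType) (c l d delta M : R) :
  0 <= c -> 1 <= l -> 2 <= d -> d ^+ 2 <= 2 * M -> c * l ^+ 3 / d <= delta ->
  c <= delta * M / l.
Proof.
move=> c0 l1 d2 dM hd.
have l0 : 0 < l by lra.
have d0 : 0 < d by lra.
have cl : 0 <= c * l ^+ 3 / d by rewrite divr_ge0 ?mulr_ge0 ?exprn_ge0 ?(ltW l0) ?(ltW d0).
have h : c * l ^+ 3 / d * (d ^+ 2 / 2) <= delta * M.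
  apply: ler_pM => //; first by rewrite divr_ge0// exprn_ge0// ltW.
  by rewrite ler_pdivrMr// mulrC.
rewrite ler_pdivlMr//; apply: le_trans h.
have -> : c * l ^+ 3 / d * (d ^+ 2 / 2) = c * l * (l ^+ 2 * d / 2).
  by field; rewrite gt_eqF.
have l2 : 1 <= l ^+ 2 by rewrite expr_ge1// ltW.
rewrite ler_peMr ?mulr_ge0 ?(ltW l0)//.
by rewrite ler_pdivlMr// mul1r; nra.
Qed.

Lemma glauber1_slow (R : realType) (T : finType) (e : rel T) (Ev Od : {set T})
    (d : nat) (delta : R) :
  symmetric e -> bipartition e Ev Od -> d_regular e d -> (2 <= d)%N ->
  (d ^ 2 <= #|T|)%N ->
  0 <= delta <= 1 -> 40 * 256 * log2 (d%:R : R) ^+ 3 / d%:R <= delta ->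
  (forall A, A != finset.set0 -> small_in e Ev A || small_in e Od A ->
     delta * #|nbhs_of e A|%:R <= #|nbhs_of e A|%:R - #|closure_of e A|%:R) ->
  ((2 `^ (delta * #|Ev|%:R / (512 * log2 d%:R)))%:E
    <= mixing_time (glauber (e := e) (1 : R)) (hard_core (e := e) (1 : R)))%E.
Proof.
move=> e_sym bip e_reg d2 dT delta01 hd hexp.
have EO := card_bip_eq e_sym bip e_reg (ltnW d2).
pose S X Y : {set indep_set e} := [set I | (#|val I :&: Y| < #|val I :&: X|)%N].
(* Exchanging the classes if necessary makes [S Ev Od] the smaller dominated family, so its
   complement has stationary mass at least 1/2. *)
wlog SS : Ev Od bip hexp EO / (#|S Ev Od| <= #|S Od Ev|)%N => [th|].
  have [SS|/ltnW SS] := leqP #|S Ev Od| #|S Od Ev|; first exact: th SS.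
  by rewrite EO; apply: th SS => //; [exact: bipartitionC|move=> A A0; rewrite orbC; exact: hexp].
have l1 : 1 <= log2 (d%:R : R) := log2_ge1 R d2.
have bal := card_balanced e_sym bip e_reg d2 delta01 hd hexp.
set l := log2 _ in l1 hd bal *; set M := #|Ev|%:R : R.
have TE : #|T|%:R = 2 * M by rewrite -(card_bip bip) -EO natrD /M; ring.
have dM : d%:R ^+ 2 <= 2 * M by rewrite -TE -natrX ler_nat.
have d2' : 2 <= d%:R :> R by rewrite ler_nat.
have Ev0 : (0 < #|Ev|)%N by rewrite -(ltr0n R) -/M; nra.
pose z := delta * M / (512 * l).
(* In fact [z >= 40 * 256 / 512 = 20]; 18 is what [2 ^ (z - 9) >= 512] needs below. *)
have z18 : 18 <= z.
  have c0 : 0 <= 40 * 256 :> R := mulr_ge0 (ler0n _ _) (ler0n _ _).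
  have := exponent_large c0 l1 d2' dM hd.
  have -> : z = delta * M / l / 512 by rewrite /z invfM; ring.
  by move: (delta * M / l) => x; lra.
pose B := [set I : indep_set e | #|val I :&: Ev| == #|val I :&: Od|].
have cardB : #|B|%:R <= 5 * 2 `^ (M - 2 * z) :> R.
  rewrite (_ : 2 * z = delta * M / (256 * l)); last first.
    by rewrite /z; field; rewrite gt_eqF//; lra.
  apply: le_trans bal; rewrite ler_nat -(card_imset _ val_inj); apply: subset_leq_card.
  by apply/fintype.subsetP => _ /imsetP[I + ->]; rewrite !inE => ->; rewrite (valP I).
have flow := @glauber1_flow R T e Ev Od (S Ev Od) B erefl erefl.
have t0 : 0 <= 2 `^ z by exact: powR_ge0.
(* Rounding up to an integer time costs at most one step, hence the [2 ^ z + 1] below. *)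
apply: (@le_trans _ _ (Num.trunc (2 `^ z)).+1%:R%:E).
  by rewrite lee_fin ltW// truncnS_gt.
apply: (@mixing_time_ge _ _ _ _ _ _ _ (S Ev Od)).
- exact: glauber1_ge0.
- exact: glauber1_sum.
- exact: glauber1_sym.
- transitivity (\sum_(I in [set: indep_set e]) hard_core (1 : R) I).
    by apply: eq_bigl => I; rewrite inE.
  rewrite hard_core1_sum cardsT divff// pnatr_eq0 -lt0n.
  by apply/card_gt0P; exists (exist _ Ev (indep_sub_class bip (fintype.subxx Ev))).
- rewrite hard_core1_sum.
  have SSub : (#|S Od Ev| <= #|~: S Ev Od|)%N.
    apply: subset_leq_card; apply/fintype.subsetP => I; rewrite !inE.
    by move/ltnW; rewrite leqNgt.
  have := cardsC (S Ev Od).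
  have om0 : (0 < #|{: indep_set e}|)%N.
    by apply/card_gt0P; exists (exist _ Ev (indep_sub_class bip (fintype.subxx Ev))).
  rewrite ler_pdivlMr ?ltr0n// mulrC ler_pdivrMr// -natrM ler_nat => <-.
  by move: SSub SS; clear; lia.
apply: (@le_lt_trans _ _ ((2 `^ z + 1) * (5 * 2 `^ (M - 2 * z)))).
  apply: ler_pM => //.
  - by apply: sumr_ge0 => I _; apply: sumr_ge0 => J _; exact: glauber1_ge0.
  - by rewrite -natr1 lerD2r truncn_le.
  - exact: le_trans flow cardB.
have SM : 2 `^ (M - 1) <= #|S Ev Od|%:R :> R.
  have := card_indep_gt bip Ev0; rewrite -(ler_nat R) -powR2_nat; apply: le_trans.
  by apply: ler_powR2; rewrite /M -{1}(prednK Ev0) -natr1 addrK.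
apply: (@lt_le_trans _ _ (2 `^ (M - 1) / 18)); last by rewrite ler_wpM2r.
(* One factor [2 ^ z] matches the elapsed time; the other, split as [2 ^ (z - 9)] and powers of 2,
   absorbs the constants 5 and 18. *)
have -> : 2 `^ (M - 1) = 2 `^ (M - 2 * z) * 2 `^ (z - 9) * (2 `^ z * 256).
  rewrite (_ : 256 = 2 `^ 8%:R); last by rewrite powR2_nat.
  by rewrite -!powR2D; congr (2 `^ _); ring.
have a0 : 0 < 2 `^ (M - 2 * z) by rewrite powR_gt0.
move: (2 `^ (M - 2 * z)) a0 => a a0.
have h9 : 512 <= 2 `^ (z - 9) :> R.
  have -> : 512 = 2 `^ 9%:R :> R by rewrite powR2_nat.
  by apply: ler_powR2; lra.
have h1 : 1 <= 2 `^ z :> R by rewrite -[leLHS](powRr0 2); apply: ler_powR2; lra.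
rewrite ltr_pdivlMr//.
have : (2 `^ z + 1) * (5 * a) <= 10 * (a * 2 `^ z) by nra.
have : a * 2 `^ z * 512 <= a * 2 `^ z * 2 `^ (z - 9).
  by rewrite ler_pM2l// mulr_gt0// powR_gt0.
have : 0 < a * 2 `^ z by rewrite mulr_gt0// powR_gt0.
by move: (2 `^ (z - 9)) => b; nra.
Qed.

Theorem corollary1p3 (R : realType) :
  exists (c c0 : R) (d0 : nat), 0 < c /\ 0 < c0 /\
    forall (d : nat), (d0 <= d)%N ->
    forall (T : finType) (e : rel T) (Ev Od : {set T}),
      simple_graph e -> bipartition e Ev Od -> d_regular e d ->
      (d ^ 2 <= #|T|)%N ->
      c * log2 (d%:R : R) ^+ 3 / d%:R <= bip_expansion e R Ev Od ->
      ((2 `^ (c0 * #|T|%:R * bip_expansion e R Ev Od / log2 d%:R))%:E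
         <= mixing_time (glauber (e := e) (1 : R)) (hard_core (e := e) (1 : R)))%E.
Proof.
(* [40 * 256] is the constant of [heavy_exponent]; [1 / 1024] is half the [1 / 512] of
   [glauber1_slow], as [N = 2 M]; [d >= 2] gives [log2 d >= 1]. *)
exists (40 * 256), (1 / 1024), 2%N; split; first exact: mulr_gt0 (ltr0Sn _ _) (ltr0Sn _ _).
split; first exact: divr_gt0 ltr01 (ltr0Sn _ _).
move=> d d2 T e Ev Od [e_sym _] bip e_reg dT hd.
set delta := bip_expansion _ _ _ _ in hd *.
have l0 : 0 < log2 (d%:R : R) by rewrite divr_gt0 ?ln_gt0 ?ltr1n.
(* The iterated minimum starts from 1. *)
have delta1 : delta <= 1 by exact: bigmin_le_id.
have delta0 : 0 <= delta.
  apply: le_trans hd; apply: divr_ge0; last exact: ler0n.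
  apply: mulr_ge0; last exact/exprn_ge0/ltW.
  exact: mulr_ge0 (ler0n _ _) (ler0n _ _).
have hexp (A : {set T}) : A != finset.set0 -> small_in e Ev A || small_in e Od A ->
    delta * #|nbhs_of e A|%:R <= #|nbhs_of e A|%:R - #|closure_of e A|%:R.
  move=> A0 sA; have NA : (0 < #|nbhs_of e A|)%N.
    by apply: leq_trans (card_le_nbhs e_sym e_reg (ltnW d2) A); rewrite card_gt0.
  rewrite -ler_pdivlMr ?ltr0n//.
  exact: (@bigmin_le_cond _ _ _ _ A _ (expansion_ratio e R)) (introT andP (conj A0 sA)).
rewrite (_ : 1 / 1024 * _ * _ / _ = delta * #|Ev|%:R / (512 * log2 d%:R)).
  exact: glauber1_slow e_sym bip e_reg d2 dT (introT andP (conj delta0 delta1)) hd hexp.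
rewrite -(card_bip bip) -(card_bip_eq e_sym bip e_reg (ltnW d2)) natrD.
by field; rewrite gt_eqF.
Qed.
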